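(* Consider the interconnected system described in the context, with a partition $\{1,\dots,n\}=I_\Sigma\cup I_{\max}$. Assume each subsystem has the asymptotic gain (AG) property in the mixed sense, i.e. there are $\overline\gamma_{ij},\overline\gamma_i\in\mathcal{K}\cup\{0\}$ such that for every initial value $x_i(0)$ and all inputs $x_j\in L_\infty(\mathbb{R}_+,\mathbb{R}^{N_j})$ ($j\ne i$), $u\in L_\infty$, the solution $x_i$ exists, is unique, and $\limsup_{t\to\infty}|x_i(t)|\le\sum_{j}\overline\gamma_{ij}(\|x_j\|_\infty)+\overline\gamma_i(\|u\|_\infty)$ if $i\in I_\Sigma$, and $\limsup_{t\to\infty}|x_i(t)|\le\max\{\max_j\overline\gamma_{ij}(\|x_j\|_\infty),\overline\gamma_i(\|u\|_\infty)\}$ if $i\in I_{\max}$. Assume further that solutions of the whole system $\dot x=f(x,u)$ exist for all positive times and are uniformly bounded. Let $\Gamma$ be the gain operator built from $(\overline\gamma_{ij})$ (with $\overline\gamma_{ii}\equiv0$). If there exists $\alpha\in\mathcal{K}_\infty$ such that $\Gamma\circ D_\alpha(s)\not\ge s$ for all $s\in\mathbb{R}^n_+\setminus\{0\}$, then the whole system has the AG property: there is $\overline\gamma\in\mathcal{K}$ with $\limsup_{t\to\infty}|x(t)|\le\overline\gamma(\|u\|_\infty)$ for all $x(0)$ and all $u\in L_\infty$.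
   Context: The interconnection is $\dot x_i=f_i(x_1,\dots,x_n,u_i)$, $i=1,\dots,n$, with $x_i\in\mathbb{R}^{N_i}$, $u_i\in\mathbb{R}^{m_i}$, where each $f_i$ is continuous and, for every $r$, locally Lipschitz in $x=(x_1^T,\dots,x_n^T)^T$ uniformly in $u_i$ with $|u_i|\le r$; it is written as $\dot x=f(x,u)$ with $u=(u_1^T,\dots,u_n^T)^T$. $\|\cdot\|_\infty$ is the essential supremum norm; $|\cdot|$ a norm. $\mathcal{K}$: continuous strictly increasing functions $\mathbb{R}_+\to\mathbb{R}_+$ vanishing at $0$; $\mathcal{K}_\infty$: unbounded ones. For $x,y\in\mathbb{R}^n$, $x\not\ge y$ means $x_i<y_i$ for some $i$. The gain operator is $\Gamma(s)=(\Gamma_1(s),\dots,\Gamma_n(s))^T$ with $\Gamma_i(s)=\sum_j\overline\gamma_{ij}(s_j)$ for $i\in I_\Sigma$ and $\Gamma_i(s)=\max_j\overline\gamma_{ij}(s_j)$ for $i\in I_{\max}$; $D_\alpha(s)=(D_1(s_1),\dots,D_n(s_n))^T$ with $D_i=\mathrm{id}+\alpha$ for $i\in I_\Sigma$ and $D_i=\mathrm{id}$ for $i\in I_{\max}$. *)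

(* Defs.v *)
From HB Require Import structures.
From mathcomp Require Import all_boot all_order all_algebra.
From mathcomp Require Import all_classical all_reals all_analysis ess_sup_inf.
Set Implicit Arguments. Unset Strict Implicit. Unset Printing Implicit Defensive.
Import Order.TTheory GRing.Theory Num.Theory.
Import numFieldNormedType.Exports.
Local Open Scope classical_set_scope.
Local Open Scope ring_scope.

Section Defs.
Variable R : realType.

Definition classK (g : R -> R) : Prop :=
  [/\ g 0 = 0,
      {within `[0, +oo[, continuous g} &
      forall x y : R, 0 <= x -> x < y -> g x < g y].

Definition classKinf (g : R -> R) : Prop :=
  classK g /\ forall M : R, exists x : R, 0 <= x /\ M < g x.

Definition classK0 (g : R -> R) : Prop := classK g \/ g = (fun _ => 0).

Definition is_norm (V : Type) (zero : V) (add : V -> V -> V)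
  (scale : R -> V -> V) (nu : V -> R) : Prop :=
  [/\ forall v, nu v = 0 -> v = zero,
      forall a v, nu (scale a v) = `|a| * nu v &
      forall v w, nu (add v w) <= nu v + nu w].

Definition vec (k : nat) := 'I_k -> R.
Definition vzero k : vec k := fun _ => 0.
Definition vadd k (v w : vec k) : vec k := fun j => v j + w j.
Definition vscale k (a : R) (v : vec k) : vec k := fun j => a * v j.
Definition vsub k (v w : vec k) : vec k := fun j => v j - w j.
Definition is_vnorm k (nu : vec k -> R) := is_norm (@vzero k) (@vadd k) (@vscale k) nu.

Definition bvec (n : nat) (D : 'I_n -> nat) := forall i : 'I_n, vec (D i).
Definition bzero (n : nat) (D : 'I_n -> nat) : bvec D := fun i => @vzero (D i).
Definition badd (n : nat) (D : 'I_n -> nat) (v w : bvec D) : bvec D := fun i => vadd (v i) (w i).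
Definition bscale (n : nat) (D : 'I_n -> nat) (a : R) (v : bvec D) : bvec D := fun i => vscale a (v i).
Definition bsub (n : nat) (D : 'I_n -> nat) (v w : bvec D) : bvec D := fun i => vsub (v i) (w i).
Definition is_bnorm n (D : 'I_n -> nat) (nu : bvec D -> R) :=
  is_norm (@bzero n D) (@badd n D) (@bscale n D) nu.

Definition bupd n (D : 'I_n -> nat) (x : bvec D) (i : 'I_n) (y : vec (D i))
  : bvec D :=
  fun j => match @eqP _ i j with
           | ReflectT e => ecast j (vec (D j)) e y
           | ReflectF _ => x j
           end.

Lemma measurable_Rplus : measurable (`[0, +oo[ : set R).
Proof. exact: measurable_itv. Qed.

Definition lebRplus := mrestr (@lebesgue_measure R) measurable_Rplus.

Definition Linf_norm (V : Type) (nu : V -> R) (v : R -> V) : \bar R :=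
  ess_sup lebRplus (fun t => (nu (v t))%:E).

Definition in_Linf k (nu : vec k -> R) (v : R -> vec k) : Prop :=
  (forall j : 'I_k, measurable_fun (`[0, +oo[ : set R) (fun t => v t j)) /\
  (Linf_norm nu v < +oo)%E.

Definition in_Linf_b n (D : 'I_n -> nat) (nu : bvec D -> R) (v : R -> bvec D)
  : Prop :=
  (forall (i : 'I_n) (j : 'I_(D i)), measurable_fun (`[0, +oo[ : set R) (fun t => v t i j)) /\
  (Linf_norm nu v < +oo)%E.

Definition limsup_oo (g : R -> R) : \bar R :=
  limf_esup (fun t => (g t)%:E) (pinfty_nbhs R).

(* z solves  z' = F t (z t), z(0) = z0, on R_+ (integral form, componentwise) *)
Definition is_solution k (F : R -> vec k -> vec k) (z0 : vec k)
  (z : R -> vec k) : Prop :=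
  z 0 = z0 /\
  forall t : R, 0 <= t -> forall j : 'I_k,
    (@lebesgue_measure R).-integrable (`[0%R, t]%classic : set R) (fun s => (F s (z s) j)%:E) /\
    ((z t j)%:E = (z0 j)%:E +
       \int[@lebesgue_measure R]_(s in (`[0%R, t]%classic : set R)) (F s (z s) j)%:E)%E.

Definition is_bsolution n (D : 'I_n -> nat)
  (F : R -> bvec D -> bvec D) (z0 : bvec D) (z : R -> bvec D) : Prop :=
  z 0 = z0 /\
  forall t : R, 0 <= t -> forall i j,
    (@lebesgue_measure R).-integrable (`[0%R, t]%classic : set R) (fun s => (F s (z s) i j)%:E) /\
    ((z t i j)%:E = (z0 i j)%:E +
       \int[@lebesgue_measure R]_(s in (`[0%R, t]%classic : set R)) (F s (z s) i j)%:E)%E.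

(* ISig = I_Sigma ; its complement is I_max ; gii = 0 convention: j <> i *)
Definition Gamma n (ISig : {set 'I_n}) (gam : 'I_n -> 'I_n -> R -> R)
  (s : 'I_n -> R) : 'I_n -> R :=
  fun i => if i \in ISig then \sum_(j < n | j != i) gam i j (s j)
           else \big[Num.max/0]_(j < n | j != i) gam i j (s j).

Definition Dalpha n (ISig : {set 'I_n}) (alpha : R -> R) (s : 'I_n -> R)
  : 'I_n -> R :=
  fun i => if i \in ISig then s i + alpha (s i) else s i.

End Defs.

(* Main.v *)
Require Import Defs.
From HB Require Import structures.
From mathcomp Require Import all_boot all_order all_algebra.
From mathcomp Require Import all_classical all_reals all_analysis ess_sup_inf.
From mathcomp Require Import measurable_realfun lra.
Import Order.TTheory GRing.Theory Num.Theory.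
Import numFieldNormedType.Exports.
Local Open Scope classical_set_scope.
Local Open Scope ring_scope.

(* Let [s_i] be the limsup of [|x_i|].  Restarting the system at a late time [tau]
   and using uniqueness for the [i]-th subsystem, the AG property gives
   [s_i <= Gamma_i(s + d) + gamu_i(|u|)] (with a max instead of the sum for [i] in
   [I_max]) for every [d > 0], because the tails of the [x_j] are bounded by
   [s_j + d]; continuity of the gains lets [d] go to [0].  The small gain condition
   turns this implicit inequality into [s_i <= phi(r)], [r] bounding the input terms:
   it exhibits the coordinates one at a time as being bounded by a class K function
   of [r].  Equivalence of norms on finite-dimensional spaces then gives the claim for
   the norm of the whole state. *)

Set Implicit Arguments. Unset Strict Implicit.

(** * Comparison functions: closure properties and inverses *)

Section comparison_functions.
Context {R : realType}.
Implicit Types g h a : R -> R.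

(** Only nonnegative points are compared, since nothing is known about a comparison function on
    negative reals. *)
Lemma within_Rplus_continuousP g :
  {within `[0, +oo[, continuous g} <->
  forall x, 0 <= x -> forall e, 0 < e -> exists2 d, 0 < d &
    forall y, 0 <= y -> `|x - y| < d -> `|g x - g y| < e.
Proof.
split.
  move=> /subspace_continuousP cg x x0 e e0.
  have /cvgrPdist_lt/(_ e e0) : g y @[y --> within `[0, +oo[ (nbhs x)] --> g x.
    by apply: cg; rewrite /= in_itv/= x0.
  rewrite near_withinE => -[d /= d0 dg]; exists d => // y y0 xy.
  by apply: dg => //; rewrite /= in_itv/= y0.
move=> cg; apply/subspace_continuousP => x /=; rewrite in_itv/= andbT => x0.
apply/cvgrPdist_lt => e e0; have [d d0 dg] := cg x x0 e e0.
rewrite near_withinE; exists d => // y /= xy; rewrite in_itv/= andbT => y0.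
exact: dg.
Qed.

Lemma classK_le g x y : classK g -> 0 <= x -> x <= y -> g x <= g y.
Proof.
move=> [_ _ ig] x0; rewrite le_eqVlt => /predU1P[->//|xy].
exact/ltW/ig.
Qed.

Lemma classK_ge0 g x : classK g -> 0 <= x -> 0 <= g x.
Proof. by move=> kg x0; case: (kg) => <- _ _; exact: classK_le. Qed.

Lemma classK0_le g x y : classK0 g -> 0 <= x -> x <= y -> g x <= g y.
Proof. by move=> [kg|->//]; exact: classK_le. Qed.

Lemma classK0_at0 g : classK0 g -> g 0 = 0.
Proof. by move=> [[]|->]. Qed.

Lemma classK0_ge0 g x : classK0 g -> 0 <= x -> 0 <= g x.
Proof. by move=> [kg|->//]; exact: classK_ge0. Qed.

Lemma classK0_continuous g : classK0 g -> {within `[0, +oo[, continuous g}.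
Proof.
move=> [[]//|->]; apply/within_Rplus_continuousP => x _ e e0.
by exists 1 => // y _ _; rewrite subrr normr0.
Qed.

Lemma classK_id : classK (@id R).
Proof. by split => //; apply: continuous_subspaceT => x; exact: cvg_id. Qed.

Lemma classKD g h : classK g -> classK0 h -> classK (fun x => g x + h x).
Proof.
move=> [g0 cg ig] kh; split.
- by rewrite g0 (classK0_at0 kh) addr0.
- move=> x; apply: cvgD; first exact: cg.
  exact: classK0_continuous.
- by move=> x y x0 xy; rewrite ltr_leD ?ig// (classK0_le kh)// ltW.
Qed.

Lemma classK_sum (T : Type) (r : seq T) g (h : T -> R -> R) :
  classK g -> (forall i, classK0 (h i)) ->
  classK (fun x => g x + \sum_(i <- r) h i x).
Proof.
move=> kg kh; elim: r => [|i r ih].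
  by under eq_fun do rewrite big_nil addr0.
under eq_fun do rewrite big_cons addrCA addrC.
exact: classKD.
Qed.

Lemma classKZ c g : 0 < c -> classK g -> classK (fun x => c * g x).
Proof.
move=> c0 [g0 cg ig]; split; first by rewrite g0 mulr0.
- by move=> x; apply: cvgM; [exact: cvg_cst|exact: cg].
- by move=> x y x0 xy; rewrite ltr_pM2l// ig.
Qed.

Lemma classK_comp g h : classK g -> classK h -> classK (g \o h).
Proof.
move=> kg kh; case: (kg) (kh) => [g0 cg ig] [h0 ch ih]; split => /=.
- by rewrite h0 g0.
- apply/within_Rplus_continuousP => x x0 e e0.
  have [d d0 gd] := (within_Rplus_continuousP g).1 cg _ (classK_ge0 kh x0) e e0.
  have [d' d'0 hd] := (within_Rplus_continuousP h).1 ch _ x0 d d0.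
  by exists d' => // y y0 xy; apply: gd; [exact: classK_ge0|exact: hd].
- by move=> x y x0 xy; rewrite ig ?ih// classK_ge0.
Qed.

Lemma classK_iter k g : classK g -> classK (iter k g).
Proof.
move=> kg; elim: k => [|k ih]; first exact: classK_id.
exact: (classK_comp kg ih).
Qed.

Lemma classKinf_surj a y : classKinf a -> 0 <= y -> exists2 x, 0 <= x & a x = y.
Proof.
move=> [ka oa] y0; have [z [z0 yz]] := oa y; case: (ka) => a0 ca ia.
have az0 := classK_ge0 ka z0.
have [||x] := @IVT R a 0 z y z0.
- by apply: continuous_subspaceW ca => x /=; rewrite !in_itv/= => /andP[->].
- by rewrite a0 min_l// max_r// y0 ltW.
- by rewrite in_itv/= => /andP[x0 _] <-; exists x.
Qed.

Lemma classK_id_add_inf a : classKinf a -> classKinf (fun x => x + a x).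
Proof.
move=> [ka oa]; split; first by apply: classKD; [exact: classK_id|left].
by move=> M; have [x [x0 Mx]] := oa M; exists x; split => //; lra.
Qed.

(** [b] is the inverse of [a] on the nonnegative reals, obtained by choice from surjectivity.
    Monotonicity of [a] transfers to [b], and squeezing [b y] between [b x - e] and [b x + e] gives
    continuity. *)
Lemma classKinf_inv a : classKinf a -> exists2 b, classK b &
  forall x y : R, 0 <= x -> 0 <= y -> a x < y -> x < b y.
Proof.
move=> kia; case: (kia) => ka _; case: (ka) => a0 ca ia.
have : forall y, exists x, 0 <= y -> 0 <= x /\ a x = y.
  move=> y; have [y0|y0] := leP 0 y; last by exists 0.
  by have [x x0 <-] := classKinf_surj kia y0; exists x.
move=> /choice[b ab].
have b_ge0 y : 0 <= y -> 0 <= b y by move=> /ab[].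
have abK y : 0 <= y -> a (b y) = y by move=> /ab[].
have a_lt x y : 0 <= x -> 0 <= y -> a x < a y -> x < y.
  by move=> x0 y0; rewrite !ltNge; apply: contra => yx; exact: classK_le.
have b_lt x y : 0 <= x -> 0 <= y -> a x < y -> x < b y.
  by move=> x0 y0 xy; apply: a_lt; rewrite ?b_ge0 ?abK.
have b_gt x y : 0 <= x -> 0 <= y -> y < a x -> b y < x.
  by move=> x0 y0 xy; apply: a_lt; rewrite ?b_ge0 ?abK.
have bb : forall x y : R, 0 <= x -> x < y -> b x < b y.
  by move=> x y x0 xy; rewrite b_lt ?abK ?b_ge0//; lra.
exists b => //; split => //.
- apply/eqP; rewrite eq_le b_ge0// andbT leNgt; apply/negP => b00.
  by have := ia 0 _ (lexx _) b00; rewrite abK// a0 ltxx.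
- apply/within_Rplus_continuousP => x x0 e e0.
  have be0 : 0 <= b x + e by have := b_ge0 _ x0; lra.
  have xb : x < a (b x + e) by rewrite -{1}(abK _ x0); apply: ia; [exact: b_ge0|lra].
  (* If [b x < e], then [b x - e] leaves the domain where [a] is controlled, but the lower estimate
     is then immediate from [0 <= b y]. *)
  have [bxe|bxe] := ltP (b x) e.
    exists (a (b x + e) - x); first lra.
    move=> y y0 xy; have : b y < b x + e by apply: b_gt => //; move: xy; rewrite ltr_distlC; lra.
    have := b_ge0 _ y0; have := b_ge0 _ x0; rewrite ltr_distlC; lra.
  have xb' : a (b x - e) < x by rewrite -{2}(abK _ x0); apply: ia; lra.
  exists (Num.min (a (b x + e) - x) (x - a (b x - e))).
    by rewrite lt_min; apply/andP; split; lra.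
  move=> y y0; rewrite lt_min => /andP[xy xy'].
  have ? : b y < b x + e by apply: b_gt => //; move: xy; rewrite ltr_distlC; lra.
  have ? : b x - e < b y by apply: b_lt => //; [lra|move: xy'; rewrite ltr_distlC; lra].
  by rewrite ltr_distlC; lra.
Qed.

End comparison_functions.

(** * From the small gain condition to an explicit bound *)

Section small_gain_bound.
Context {R : realType} {n : nat} {ISig : {set 'I_n}}
  {gam : 'I_n -> 'I_n -> R -> R} {alpha : R -> R}.
Hypothesis Hgam : forall i j, classK0 (gam i j).
Hypothesis Kalpha : classKinf alpha.
Hypothesis Hsg : forall s : 'I_n -> R, (forall i, 0 <= s i) ->
  (exists i, s i != 0) -> exists i, Gamma ISig gam (Dalpha ISig alpha s) i < s i.

(* Zero out the coordinates of [s] that are at most [c] and apply the hypothesis to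
   the [D_alpha]-preimage of the result: as long as some coordinate exceeds [c], one
   of those is at most [psi c].  Hence at least [k] coordinates are bounded by
   [iter k psi r]. *)
Lemma small_gain_bound : exists2 phi : R -> R, classK phi &
  forall (s : 'I_n -> R) (r : R), 0 <= r -> (forall i, 0 <= s i) ->
  (forall i, s i <= if i \in ISig then Gamma ISig gam s i + r
                    else Num.max (Gamma ISig gam s i) r) ->
  forall i, s i <= phi r.
Proof.
have [b kb blt] := classKinf_inv Kalpha.
(* [q c] dominates every single gain at [c] and every [c] plus a row sum of gains; the summand [c]
   keeps it in class K even if all gains vanish. *)
pose q := fun c => c + \sum_(ij : 'I_n * 'I_n) gam ij.1 ij.2 c.
have kq : classK q by apply: classK_sum => //; exact: classK_id.
(* As [b] inverts [alpha], [alpha p < q c] forces [p + alpha p < psi c]; this is how the margin in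
   [Dalpha] is exploited. *)
pose psi := fun c => q c + b (q c).
have kpsi : classK psi by apply: classKD => //; left; exact: (@classK_comp _ b q).
have q_ge (c : R) : 0 <= c -> c <= q c.
  by move=> c0; rewrite lerDl sumr_ge0// => ij _; exact: classK0_ge0.
have psi_ge (c : R) : 0 <= c -> c <= psi c.
  move=> c0; have cq := q_ge _ c0; rewrite (le_trans cq)// lerDl.
  by apply: classK_ge0 => //; lra.
have gam_q i j (c : R) : 0 <= c -> gam i j c <= q c.
  move=> c0; rewrite /q (bigD1 (i, j))//= addrCA lerDl addr_ge0// sumr_ge0//.
  by move=> ij _; exact: classK0_ge0.
have gamsum_q i (c : R) : 0 <= c -> c + \sum_(j < n) gam i j c <= q c.
  move=> c0; rewrite lerD2l.
  rewrite -(pair_bigA _ (fun i j => gam i j c))/= [leRHS](bigD1 i)//= lerDl.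
  by rewrite sumr_ge0// => k _; rewrite sumr_ge0// => l _; exact: classK0_ge0.
exists (iter n psi); first exact: classK_iter.
move=> s r r0 s0 sle.
have iter_ge k : r <= iter k psi r.
  elim: k => //= k ih; rewrite (le_trans ih)// psi_ge//; lra.
pose A (c : R) : {set 'I_n} := [set i | s i <= c]%SET.
suff card_small k : (k <= n)%N -> (k <= #|A (iter k psi r)|)%N.
  have := card_small n (leqnn n).
  rewrite -{1}(card_ord n) -cardsT => nA i.
  have /eqP AT : A (iter n psi r) == [set: 'I_n]%SET.
    by rewrite eqEcard finset.subsetT.
  by have := finset.in_setT i; rewrite -AT inE.
elim: k => [//|k ih kn]; set c := iter k psi r.
have rc : r <= c := iter_ge k; have c0 : 0 <= c by lra.
have {ih} ih : (k <= #|A c|)%N by apply: ih; exact: ltnW.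
have sub : A c \subset A (psi c).
  apply/fintype.subsetP => i; rewrite !inE => sic.
  by rewrite (le_trans sic)// psi_ge.
(* A coordinate in the gap between [c] and [psi c] enlarges the set of bounded coordinates strictly.
   Otherwise every coordinate above [c] is even above [psi c], which is possible only if there is
   none. *)
have [[i [ci ip]]|none] := pselect (exists i, c < s i /\ s i <= psi c).
  apply: leq_ltn_trans ih _; apply: proper_card; rewrite properE sub/=.
  by apply/subsetPn; exists i; rewrite !inE//= -ltNge.
have big i : c < s i -> psi c < s i.
  by move=> ci; rewrite ltNge; apply/negP => ip; apply: none; exists i.
have [allsmall|/existsNP[i0 /negP]] := pselect (forall i, s i <= c).
  apply: leq_trans (subset_leq_card sub); rewrite (_ : A c = [set: 'I_n]%SET).
    by rewrite cardsT card_ord.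
  by apply/setP => i; rewrite !inE allsmall.
rewrite -ltNge => ci0; exfalso.
pose s' i := if c < s i then s i else 0.
have s'0 i : 0 <= s' i by rewrite /s'; case: ifP.
have : forall i, exists p : R, 0 <= p /\ (if i \in ISig then p + alpha p else p) = s' i.
  move=> i; have [_|_] := boolP (i \in ISig); last by exists (s' i).
  have [p p0 ps] := classKinf_surj (classK_id_add_inf Kalpha) (s'0 i).
  by exists p.
move=> /choice[p /all_and2[p0 Dp]].
have DpE : Dalpha ISig alpha p = s' by apply/funext => i; rewrite /Dalpha Dp.
have alpha0 : alpha 0 = 0 by case: Kalpha => -[].
(* The small gain condition at [p] yields an index [i] with [Gamma] of [s'] below [p i]; positivity
   of [p i] then shows that coordinate [i] was not zeroed out. *)
have [|i] := Hsg p0.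
  exists i0; apply/eqP => pi0; have := Dp i0.
  by rewrite pi0 alpha0 addr0 if_same /s' ci0; lra.
rewrite DpE => Gp.
have G0 : 0 <= Gamma ISig gam s' i.
  rewrite /Gamma; case: ifP => _; first by rewrite sumr_ge0// => j _; exact: classK0_ge0.
  by apply/bigmax_geP; left.
have ppos : 0 < p i by lra.
have a0 : 0 <= alpha (p i) by apply: classK_ge0 => //; case: Kalpha.
have ci : c < s i.
  rewrite ltNge; apply/negP => sic; have := Dp i; rewrite /s' ltNge sic/=.
  by case: ifP => _; lra.
have psii := big _ ci.
(* Large coordinates survive in [s'], the others contribute at most the gain at [c]. *)
have gamle j : gam i j (s j) <= Num.max (gam i j (s' j)) (gam i j c).
  rewrite /s' le_max; case: ifPn => [_|]; first by rewrite lexx.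
  by rewrite -leNgt => sjc; rewrite [X in _ || X](classK0_le (Hgam i j))// orbT.
have := Dp i; have -> : s' i = s i by rewrite /s' ci.
have := sle i.
(* In the sum case, [p i + alpha (p i) = s i < p i + q c], so [alpha (p i) < q c] and hence
   [s i < psi c], a contradiction. In the maximum case [p i = s i], and each term of the maximum is
   strictly below [s i]. *)
move: Gp G0; rewrite /Gamma; case: ifPn => iS Gp G0 si pi.
  have gamsum : \sum_(j < n | j != i) gam i j (s j) <=
      \sum_(j < n | j != i) gam i j (s' j) + \sum_(j < n) gam i j c.
    rewrite [X in _ + X](bigD1 i)//= addrCA ler_wpDl ?(classK0_ge0 (Hgam i i))//.
    rewrite -big_split /= ler_sum// => j _; rewrite (le_trans (gamle j))//.
    by rewrite ge_max lerDl lerDr !(classK0_ge0 (Hgam i j)).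
  have qc := gamsum_q i c c0.
  have := blt (p i) (q c) (p0 i); move: psii; rewrite /psi.
  have := q_ge _ c0; lra.
have qs : q c < s i.
  rewrite (le_lt_trans _ psii)// lerDl; apply: classK_ge0 => //.
  by have := q_ge _ c0; lra.
suff : s i < s i by rewrite ltxx.
apply: le_lt_trans si _; rewrite gt_max (le_lt_trans rc ci) andbT.
apply/bigmax_ltP; split; first lra.
move=> j ji; rewrite (le_lt_trans (gamle j))// gt_max.
rewrite (le_lt_trans (gam_q i j c c0) qs) andbT -pi (le_lt_trans _ Gp)//.
by apply: (@le_bigmax_cond _ _ _ 0 j (fun j => j != i) (fun j => gam i j (s' j))).
Qed.

End small_gain_bound.


(** * Equivalence of norms on finite-dimensional spaces and block vectors *)

Section is_norm_theory.
Context {R : realType} {V : Type} {zero : V} {add : V -> V -> V}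
  {scale : R -> V -> V} {nu : V -> R}.
Hypothesis nu_norm : is_norm zero add scale nu.
Hypothesis scale0 : forall v, scale 0 v = zero.
Hypothesis scaleN1 : forall v, add v (scale (- 1) v) = zero.

Lemma is_norm0 : nu zero = 0.
Proof. by case: nu_norm => _ nZ _; rewrite -(scale0 zero) nZ normr0 mul0r. Qed.

Lemma is_norm_ge0 v : 0 <= nu v.
Proof.
case: nu_norm => _ nZ nD; have := nD v (scale (- 1) v).
by rewrite scaleN1 is_norm0 nZ normrN1 mul1r; lra.
Qed.

End is_norm_theory.

Lemma coord_le_mx_norm (R : realType) k (v : 'rV[R]_k) j : `|v ord0 j| <= `|v|.
Proof.
rewrite [leRHS](_ : _ = mx_norm v)// mx_normrE.
exact: (le_bigmax _ (fun ij => `|v ij.1 ij.2|) (ord0, j)).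
Qed.

Section norm_equivalence.
Context {R : realType} {T : finType}.
Variable nu : (T -> R) -> R.
Hypothesis nu_norm : is_norm (fun=> 0) (fun v w t => v t + w t)
  (fun a v t => a * v t) nu.

Let nu0 : nu (fun=> 0) = 0.
Proof. by apply: (is_norm0 nu_norm) => v; apply/funext => t; rewrite mul0r. Qed.

Let nu_ge0 v : 0 <= nu v.
Proof.
apply: (is_norm_ge0 nu_norm) => w; apply/funext => t; first by rewrite mul0r.
by rewrite mulN1r subrr.
Qed.

(** Expand [v] in the canonical basis and use the triangle inequality. The added 1 makes the
    constant positive even for empty [T]. *)
Lemma norm_le_sum_coord : exists2 C, 0 < C &
  forall v, nu v <= C * \sum_t `|v t|.
Proof.
case: nu_norm => _ nZ nD.
pose e t : T -> R := fun t' => (t' == t)%:R.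
have nusum v (r : seq T) :
    nu (fun t => \sum_(i <- r) v i * e i t) <= \sum_(i <- r) `|v i| * nu (e i).
  elim: r => [|i r ih].
    by under eq_fun do rewrite big_nil; rewrite nu0 big_nil.
  under eq_fun do rewrite big_cons; rewrite big_cons.
  by rewrite (le_trans (nD _ _))// lerD// nZ.
exists (1 + \sum_t nu (e t)).
  by rewrite ltr_wpDr// sumr_ge0.
move=> v; have -> : v = fun t => \sum_i v i * e i t.
  apply/funext => t; rewrite (bigD1 t)//= /e eqxx mulr1 big1 ?addr0// => i it.
  by rewrite eq_sym (negbTE it) mulr0.
apply: le_trans (nusum _ _) _; rewrite mulr_sumr ler_sum// => i _.
have -> : \sum_i0 v i0 * e i0 i = v i.
  rewrite (bigD1 i)//= /e eqxx mulr1 big1 ?addr0// => j ij.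
  by rewrite eq_sym (negbTE ij) mulr0.
rewrite mulrC ler_wpM2r// (bigD1 i)//= addrCA lerDl addr_ge0// sumr_ge0//.
Qed.

Let k := #|T|.
Let F (v : 'rV[R]_k) : T -> R := fun t => v ord0 (enum_rank t).

(** The bound by coordinates makes [nu] Lipschitz for the sup norm of row vectors, which supplies
    the topology for the compactness argument. *)
Let F_continuous : continuous (nu \o F).
Proof.
case: nu_norm => _ nZ nD; have [C C0 nC] := norm_le_sum_coord.
have nB v w : nu (F v) <= nu (F w) + C * (k%:R * `|v - w|).
  have -> : F v = (fun t => F w t + F (v - w) t).
    by apply/funext => t; rewrite /F !mxE subrKC.
  rewrite (le_trans (nD _ _))// lerD2l (le_trans (nC _))// ler_pM2l//.
  have -> : k%:R * `|v - w| = \sum_(t : T) `|v - w| by rewrite sumr_const mulr_natl.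
  by rewrite ler_sum// => t _; exact: coord_le_mx_norm.
move=> v; have v_filter : Filter (nbhs v) by exact: nbhs_filter.
apply/cvgrPdist_lt => e e0.
have K0 : 0 < C * (k%:R + 1) by rewrite mulr_gt0// ltr_wpDl.
apply: (proj2 (@nbhs_ballP R 'rV[R]_k v _)); exists (e / (C * (k%:R + 1))); first by rewrite /= divr_gt0.
move=> w; rewrite -ball_normE /= => vw.
have : C * (k%:R * `|v - w|) < e.
  move: vw; rewrite ltr_pdivlMr//; apply: le_lt_trans.
  rewrite mulrA [leRHS]mulrC ler_wpM2r// ler_pM2l//; lra.
have := nB v w; have := nB w v; rewrite (distrC w v) ltr_distlC/=; lra.
Qed.

(* The coordinates are bounded because [nu] has a positive minimum on the
   sup-norm unit sphere. *)
Lemma coord_le_norm : exists2 C, 0 < C & forall v t, `|v t| <= C * nu v.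
Proof.
case: (nu_norm) => n0 nZ nD.
pose S := [set v : 'rV[R]_k | `|v| = 1].
have normF v t : `|F v t| <= `|v| by exact: coord_le_mx_norm.
pose G (v : T -> R) : 'rV[R]_k := \row_j v (enum_val j).
have GK v : F (G v) = v by apply/funext => t; rewrite /F mxE enum_rankK.
have cS : compact S.
  apply: bounded_closed_compact.
    by exists 1; split => // x x1 v /= ->; exact: ltW.
  rewrite (_ : S = (fun v : 'rV[R]_k => `|v|) @^-1` [set 1])//.
  apply: closed_comp; last exact: closed_eq.
  by move=> v _; exact: norm_continuous.
have unit v : `|G v| != 0 -> S (`|G v|^-1 *: G v).
  by move=> v0; rewrite /S/= normrZ normfV normr_id mulVf.
(* The sphere is empty when [T] is; every row vector then has norm zero and the constant 1 works. *)
have [[v0 Sv0]|noS] := pselect (S !=set0).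
  have [//||c] := @compact_EVT_min _ R (nu \o F) S _ cS.
  - by exists v0.
  - exact/continuous_subspaceT/F_continuous.
  rewrite inE => Sc cmin.
  have nc : 0 < nu (F c).
    rewrite lt_neqAle nu_ge0 andbT eq_sym; apply/eqP => /n0 Fc.
    have : `|c| = 0.
      apply/eqP; rewrite normr_eq0; apply/eqP/rowP => j.
      by have := congr1 (fun f => f (enum_val j)) Fc; rewrite /F enum_valK !mxE.
    by rewrite Sc => /eqP; rewrite oner_eq0.
  exists (nu (F c))^-1; first by rewrite invr_gt0.
  move=> v t; rewrite -[v in leLHS]GK (le_trans (normF _ _))//.
  have [->|vn0] := eqVneq `|G v| 0; first by rewrite mulr_ge0// invr_ge0 ltW.
  have := cmin _ (mem_set (unit v vn0)) => /=.
  have -> : F (`|G v|^-1 *: G v) = (fun t => `|G v|^-1 * v t).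
    by apply/funext => t'; rewrite /F !mxE enum_rankK.
  rewrite nZ normfV normr_id ler_pdivlMl; last by rewrite lt_neqAle eq_sym vn0/=.
  by rewrite ler_pdivlMl// mulrC.
exists 1 => // v t; rewrite -[v in leLHS]GK (le_trans (normF _ _))//.
have [->|vn0] := eqVneq `|G v| 0; first by rewrite mul1r.
by exfalso; apply: noS; exists (`|G v|^-1 *: G v); exact: unit.
Qed.

End norm_equivalence.

Section block_norms.
Context {R : realType} {n : nat} {D : 'I_n -> nat}.
Variables (nuX : bvec R D -> R) (nuS : forall i, vec R (D i) -> R).
Arguments nuS : clear implicits.
Hypotheses (HX : is_bnorm nuX) (HS : forall i, is_vnorm (nuS i)).

Lemma vnorm_ge0 i v : 0 <= nuS i v.
Proof.
apply: (is_norm_ge0 (HS i)) => w; apply/funext => j; rewrite /vscale ?mul0r//.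
by rewrite /vadd mulN1r subrr.
Qed.

Lemma bnorm_ge0 v : 0 <= nuX v.
Proof.
apply: (is_norm_ge0 HX) => w; apply: functional_extensionality_dep => i.
  by apply/funext => j; rewrite /bscale /vscale mul0r.
by apply/funext => j; rewrite /badd /vadd /bscale /vscale mulN1r subrr.
Qed.

(** Block vectors are flattened to functions on the finite type of pairs (block, coordinate), so
    that norm equivalence applies to them. *)
Let T : finType := {i : 'I_n & 'I_(D i)}.
Let unflat (v : T -> R) : bvec R D := fun i j => v (Tagged (fun i => 'I_(D i)) j).
Let flat (x : bvec R D) : T -> R := fun t => x (tag t) (tagged t).

Let flat_norm : is_norm (fun=> 0) (fun v w t => v t + w t)
  (fun a v t => a * v t) (nuX \o unflat).
Proof.
case: HX => n0 nZ nD; split.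
- move=> v /n0 v0; apply/funext => -[i j].
  exact: (congr1 (fun x : bvec R D => x i j) v0).
- by move=> a v; exact: nZ.
- by move=> v w; exact: nD.
Qed.

Lemma block_le_bnorm : exists2 C, 0 < C & forall x i, nuS i (x i) <= C * nuX x.
Proof.
have [C C0 xC] := coord_le_norm flat_norm.
have H i := norm_le_sum_coord (HS i).
have /choice[c Hc] : forall i, exists c, 0 < c /\
    forall v, nuS i v <= c * \sum_(t < D i) `|v t|.
  by move=> i; have [c c0 hc] := H i; exists c.
exists (1 + \sum_i c i * ((D i)%:R * C)).
  rewrite ltr_wpDr// sumr_ge0// => i _; have [c0 _] := Hc i.
  by rewrite mulr_ge0 ?mulr_ge0// ltW.
move=> x i; have [c0 /(_ (x i)) hc] := Hc i; apply: le_trans hc _.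
apply: (@le_trans _ _ (c i * ((D i)%:R * C) * nuX x)).
  rewrite -!mulrA ler_pM2l//.
  have -> : (D i)%:R * (C * nuX x) = \sum_(t < D i) C * nuX x.
    by rewrite sumr_const card_ord mulr_natl.
  by rewrite ler_sum// => j _; exact: (xC (flat x) (Tagged (fun i => 'I_(D i)) j)).
rewrite ler_wpM2r ?bnorm_ge0// (bigD1 i)//= addrCA lerDl addr_ge0// sumr_ge0//.
move=> l _; have [cl0 _] := Hc l.
by rewrite mulr_ge0 ?mulr_ge0// ltW.
Qed.

Lemma bnorm_le_sum_block : exists2 C, 0 < C &
  forall x, nuX x <= C * \sum_i nuS i (x i).
Proof.
have [C C0 xC] := norm_le_sum_coord flat_norm.
have H i := coord_le_norm (HS i).
have /choice[c Hc] : forall i, exists c, 0 < c /\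
    forall v t, `|v t| <= c * nuS i v.
  by move=> i; have [c c0 hc] := H i; exists c.
pose K := \sum_(t : T) c (tag t).
have K0 : 0 <= K by rewrite sumr_ge0// => t _; rewrite ltW//; case: (Hc (tag t)).
exists (C * (1 + K)); first by rewrite mulr_gt0// ltr_wpDr.
move=> x; apply: le_trans (xC (flat x)) _; rewrite -mulrA ler_pM2l//.
have S0 : 0 <= \sum_i nuS i (x i) by rewrite sumr_ge0// => i _; exact: vnorm_ge0.
rewrite mulrDl mul1r ler_wpDl// mulr_suml ler_sum// => -[i j] _ /=.
have [ci /(_ (x i) j) hc] := Hc i; rewrite (le_trans hc)// ler_pM2l//.
by rewrite (bigD1 i)//= lerDl sumr_ge0// => l _; exact: vnorm_ge0.
Qed.

End block_norms.


(** * Translation invariance of integrals and integral equations *)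

Section time_shift.
Context {R : realType}.
Local Notation mu := (@lebesgue_measure R).
Variable tau : R.
Local Notation shift := ((fun t : R => t + tau) : measurableTypeR R -> measurableTypeR R).

Lemma measurable_shift : measurable_fun [set: measurableTypeR R] shift.
Proof. by apply: measurable_funD => //; exact: measurable_cst. Qed.

Lemma shift_preimage_itvcc a b :
  shift @^-1` `[a + tau, b + tau] = `[a, b]%classic.
Proof. by apply/seteqP; split => t /=; rewrite !in_itv/= !lerD2r. Qed.

(** The pushforward by the translation agrees with Lebesgue measure on half-open intervals, so
    uniqueness applies. *)
Lemma lebesgue_measure_shift (A : set R) : measurable A ->
  mu (shift @^-1` A) = mu A.
Proof.
move=> mA; rewrite -[LHS]/(pushforward mu shift A).
apply/esym/lebesgue_measure_unique => //=; first exact: measurable_shift.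
move=> _ _ [[a b]] _ <-.
rewrite /pushforward/= (_ : _ @^-1` _ = `]a - tau, b - tau]%classic).
  rewrite !lebesgue_measure_itv/= !lte_fin ltrD2r; case: ifPn => // _.
  by rewrite -!EFinB; congr EFin; lra.
by apply/seteqP; split => t /=; rewrite !in_itv/= ltrBlDr lerBrDr.
Qed.

Local Open Scope ereal_scope.

Lemma ge0_integral_shift (D : set R) (f : R -> \bar R) : measurable D ->
  measurable_fun D f -> (forall t, 0 <= f t) ->
  \int[mu]_(t in shift @^-1` D) f (t + tau)%R = \int[mu]_(t in D) f t.
Proof.
move=> mD mf f0.
transitivity (\int[pushforward mu shift]_(t in D) f t).
  apply/esym; rewrite (ge0_integral_pushforward measurable_shift mu mD mf)//.
apply: eq_measure_integral => /=; first exact: measurable_shift.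
by move=> _ A mA _; exact: lebesgue_measure_shift.
Qed.

Lemma integral_shift (D : set R) (f : R -> \bar R) : measurable D ->
  measurable_fun D f ->
  \int[mu]_(t in shift @^-1` D) f (t + tau)%R = \int[mu]_(t in D) f t.
Proof.
move=> mD mf; rewrite integralE [RHS]integralE; congr (_ - _).
- rewrite -(ge0_integral_shift mD (measurable_funepos mf) (funepos_ge0 f)).
  by apply: eq_integral => t _; rewrite !funeposE.
- rewrite -(ge0_integral_shift mD (measurable_funeneg mf) (funeneg_ge0 f)).
  by apply: eq_integral => t _; rewrite !funenegE.
Qed.

Lemma integrable_shift (D : set R) (f : R -> \bar R) : measurable D ->
  mu.-integrable D f ->
  mu.-integrable (shift @^-1` D) (fun t => f (t + tau)%R).
Proof.
move=> mD /integrableP[mf foo].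
have mD' : measurable (shift @^-1` D).
  by rewrite -[X in measurable X]setTI; exact: measurable_shift.
apply/integrableP; split.
  apply: (measurable_comp mD _ mf); first by move=> _ [t Dt <-].
  exact: measurable_funTS measurable_shift.
rewrite (@ge0_integral_shift D (fun t => `|f t|))//.
exact: measurableT_comp.
Qed.

End time_shift.

Section primitives.
Context {R : realType}.
Local Notation mu := (@lebesgue_measure R).
Variables (h y : R -> R) (y0 : R).
Hypothesis hy : forall t : R, 0 <= t ->
  mu.-integrable `[0, t] (fun s => (h s)%:E) /\
  ((y t)%:E = y0%:E + \int[mu]_(s in `[0%R, t]) (h s)%:E)%E.

(** On each [[0, k]] the primitive is continuous, and these intervals exhaust the half-line. This is
    what makes solution blocks admissible as inputs of other subsystems. *)
Lemma measurable_primitive : measurable_fun (`[0, +oo[ : set R) y.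
Proof.
rewrite (_ : (`[0, +oo[%classic : set R) = \bigcup_k `[0, k%:R]%classic); last first.
  apply/seteqP; split => t /=; last by move=> [k _] /=; rewrite !in_itv/= => /andP[->].
  rewrite in_itv/= andbT => t0; exists (Num.truncn t).+1 => //=.
  by rewrite in_itv/= t0/= ltW// truncnS_gt.
apply/measurable_fun_bigcup => // k.
apply: (@eq_measurable_fun _ _ _ _ _
  (fun t => y0 + parameterized_integral mu 0 t h)).
  move=> t; rewrite inE/= in_itv/= => /andP[t0 tk].
  have [_ yt] := hy t0; apply: EFin_inj; rewrite yt EFinD; congr (_ + _)%E.
  rewrite /parameterized_integral /Rintegral fineK//.
  by apply: integrable_fin_num => //; case: (hy t0).
apply: measurable_funD; first exact: measurable_cst.
apply: subspace_continuous_measurable_fun => //.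
apply: parameterized_integral_continuous => //.
by have [] := @hy k%:R (ler0n _ _).
Qed.

Lemma shift_primitive (tau t : R) : 0 <= tau -> 0 <= t ->
  mu.-integrable `[0, t] (fun s => (h (s + tau))%:E) /\
  ((y (t + tau))%:E = (y tau)%:E + \int[mu]_(s in `[0%R, t]) (h (s + tau))%:E)%E.
Proof.
move=> tau0 t0; have tt0 : 0 <= t + tau by lra.
have [itt ytt] := hy tt0; have [itau ytau] := hy tau0.
have E : `[0, t]%classic = ((fun s : R => s + tau) : measurableTypeR R -> measurableTypeR R) @^-1` `[tau, t + tau].
  by rewrite -(shift_preimage_itvcc tau) add0r.
have itt' : mu.-integrable `[tau, t + tau] (fun s => (h s)%:E).
  apply: integrableS itt => //; apply: subset_itvr; rewrite bnd_simp; lra.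
split.
  rewrite E; apply: (@integrable_shift _ tau `[tau, t + tau]%classic (fun s => (h s)%:E)) => //.
rewrite ytt ytau -addeA; congr (_ + _)%E.
rewrite E (@integral_shift _ tau `[tau, t + tau]%classic (fun s => (h s)%:E))//; last first.
  exact: measurable_int itt'.
(* The interval up to [t + tau] is cut at [tau], with [tau] in the left piece; closing the right
   piece at [tau] does not change the integral. *)
rewrite (@itv_bndbnd_setU _ _ _ (BRight tau)) ?bnd_simp//; [|lra].
rewrite integral_setU//=.
- congr (_ + _)%E; rewrite integral_itv_obnd_cbnd//.
  apply: measurable_funS (measurable_int _ itt') => //.
  by apply: subset_itvr; rewrite bnd_simp.
- rewrite -itv_bndbnd_setU ?bnd_simp//; [|lra].
  exact: measurable_int itt.
- apply/disj_set2P; rewrite -subset0 => z/=; rewrite !in_itv/= => -[/andP[_]].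
  by rewrite leNgt => /negbTE ->.
Qed.

End primitives.

(** * Essential supremum norm and limit superior at infinity *)

Section Linf_norm_theory.
Context {R : realType} {V : Type}.
Variable nu : V -> R.
Implicit Type v : R -> V.

Lemma Linf_norm_ge0 v : (forall w, 0 <= nu w) -> (0 <= Linf_norm nu v)%E.
Proof.
move=> nu0; apply: ess_sup_gee; last by apply: nearW => t; rewrite lee_fin.
by rewrite /= /lebRplus /mrestr setTI lebesgue_measure_itv/= ltry addye// ltry.
Qed.

Lemma Linf_norm_le v M : (forall t, 0 <= t -> nu (v t) <= M) ->
  (Linf_norm nu v <= M%:E)%E.
Proof.
(* The measure is restricted to nonnegative times, so the negative half-line is a null set. *)
move=> vM; apply/ess_supP; exists `]-oo, 0[%classic; split => //.
  rewrite /= /lebRplus /mrestr (_ : _ `&` _ = set0) ?measure0//.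
  by rewrite -subset0 => t [] /=; rewrite !in_itv/= => /lt_geF ->.
move=> t /= tM; rewrite in_itv/= ltNge; apply/negP => t0; apply: tM.
by rewrite lee_fin vM.
Qed.

(** The translate of an exceptional null set is again null: a nonnegative shift sends nonnegative
    times to nonnegative times, so only the part of the set there matters. *)
Lemma Linf_norm_shift v (tau : R) : 0 <= tau ->
  (Linf_norm nu (fun t => v (t + tau)%R) <= Linf_norm nu v)%E.
Proof.
move=> tau0; apply/ess_supP.
have [N [mN N0 Nsub]] := ess_sup_ge (@lebRplus R) (fun t => (nu (v t))%:E).
have mN' : measurable (N `&` (`[0, +oo[ : set R)) by exact: measurableI.
have mtau (A : set R) : measurable A ->
    measurable (((fun t : R => t + tau) : measurableTypeR R -> measurableTypeR R) @^-1` A).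
  by move=> mA; rewrite -[X in measurable X]setTI; exact: measurable_shift.
exists (((fun t : R => t + tau) : measurableTypeR R -> measurableTypeR R) @^-1` N); split.
- exact: mtau.
- apply: (@subset_measure0 _ _ _ (@lebesgue_measure R) _
    (((fun t : R => t + tau) : measurableTypeR R -> measurableTypeR R) @^-1` (N `&` (`[0, +oo[ : set R)))).
  + by apply: measurableI => //; exact: mtau.
  + exact: mtau.
  + by move=> t [Nt] /=; rewrite !in_itv/= !andbT => t0; split => //; exact: addr_ge0.
  + exact: etrans (lebesgue_measure_shift tau mN') N0.
- by move=> t /= tM; apply: Nsub => /= tM'; exact: tM.
Qed.

End Linf_norm_theory.

Section limsup_oo_theory.
Context {R : realType}.
Implicit Types (g : R -> R) (a T : R).

Lemma limsup_oo_le g a T : (forall t, T <= t -> g t <= a) ->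
  (limsup_oo g <= a%:E)%E.
Proof.
move=> ga; apply: (@le_trans _ _ (ereal_sup ((fun t => (g t)%:E) @` [set t | T < t]))).
  apply: ereal_inf_lbound; exists [set t | T < t] => //.
  by exists T; split => //; exact: num_real.
by apply: ge_ereal_sup => _ [t /= Tt <-]; rewrite lee_fin ga// ltW.
Qed.

Lemma limsup_oo_lt g a : (limsup_oo g < a%:E)%E ->
  exists2 T, 0 <= T & forall t, T <= t -> g t <= a.
Proof.
move=> /ereal_inf_lt[_ [A [M [_ MA] <-]]] supa.
exists (`|M| + 1); first by rewrite addr_ge0.
move=> t Mt; rewrite -lee_fin; apply: le_trans (ltW supa).
apply: ereal_sup_ubound; exists t => //; apply: MA.
by rewrite (le_lt_trans (ler_norm M))//; lra.
Qed.

Lemma limsup_oo_ge0 g : (forall t, 0 <= g t) -> (0 <= limsup_oo g)%E.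
Proof.
move=> g0; apply: limf_esup_ge0; last by move=> t; rewrite lee_fin.
by move=> [M [_ M0]]; apply: (M0 (M + 1)); rewrite ltrDl.
Qed.

End limsup_oo_theory.

(** * Solutions restarted at a later time *)

Section shifted_solutions.
Context {R : realType} {n : nat} {N m : 'I_n -> nat}.
Variable f : forall i : 'I_n, bvec R N -> vec R (m i) -> vec R (N i).
Variables (x0 : bvec R N) (u : R -> bvec R m) (x : R -> bvec R N).
Arguments f : clear implicits.
Arguments x0 : clear implicits.
Arguments u : clear implicits.
Arguments x : clear implicits.
Hypothesis solx : is_bsolution (fun t z => fun i => f i z (u t i)) x0 x.
Variable tau : R.
Hypothesis tau0 : 0 <= tau.

Lemma bupd_self (z : bvec R N) i : bupd z (z i) = z.
Proof.
apply: functional_extensionality_dep => j; rewrite /bupd.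
by case: eqP => // ij; destruct ij.
Qed.

Lemma shift_bsolution_primitive i j t : 0 <= t ->
  (@lebesgue_measure R).-integrable `[0, t]
    (fun s => (f i (x (s + tau)) (u (s + tau) i) j)%:E) /\
  ((x (t + tau) i j)%:E = (x tau i j)%:E + \int[@lebesgue_measure R]_(s in `[0%R, t])
    (f i (x (s + tau)) (u (s + tau) i) j)%:E)%E.
Proof.
case: solx => _ sol.
exact: (@shift_primitive R (fun s => f i (x s) (u s i) j) (fun s => x s i j)
  (x0 i j) (fun s s0 => sol s s0 i j) tau t tau0).
Qed.

(** With the other blocks read as inputs, block [i] of a global solution solves the [i]-th
    subsystem, because putting a block back in its own place changes nothing. Uniqueness for the
    subsystem can then be invoked. *)
Lemma shift_bsolution i :
  is_solution (fun t z => f i (bupd (x (t + tau)) z) (u (t + tau) i))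
    (x tau i) (fun t => x (t + tau) i).
Proof.
split; first by rewrite add0r.
move=> t t0 j; have [intf xE] := shift_bsolution_primitive j t0; split.
  by apply: eq_integrable intf => // s _; rewrite bupd_self.
rewrite xE; congr (_ + _)%E.
by apply: eq_integral => s _; rewrite bupd_self.
Qed.

Lemma measurable_shift_bsolution i j :
  measurable_fun (`[0, +oo[ : set R) (fun t => x (t + tau) i j).
Proof. exact: measurable_primitive (shift_bsolution_primitive j). Qed.

End shifted_solutions.

Lemma in_Linf_b_shift (R : realType) (n : nat) (D : 'I_n -> nat)
    (nu : bvec R D -> R) (v : R -> bvec R D) (tau : R) : 0 <= tau ->
  in_Linf_b nu v -> in_Linf_b nu (fun t => v (t + tau)).
Proof.
move=> tau0 [mv voo]; split; last exact: le_lt_trans (Linf_norm_shift _ _ tau0) voo.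
move=> i j; rewrite (_ : (fun t => _) = (fun t => v t i j) \o (fun t => t + tau))//.
apply: (measurable_comp _ _ (mv i j)) => //.
  by move=> _ [t /= + <-]; rewrite !in_itv/= !andbT => t0; exact: addr_ge0.
exact: measurable_funTS (measurable_shift tau).
Qed.

(** * The right-hand side of the mixed gain estimate *)

Section mixed_gain.
Context {R : realType} {n : nat} (ISig : {set 'I_n})
  (gam : 'I_n -> 'I_n -> R -> R).
Hypothesis Hgam : forall i j, classK0 (gam i j).

Definition mixed_gain (s : 'I_n -> R) (r : R) (i : 'I_n) : R :=
  if i \in ISig then \sum_(j < n | j != i) gam i j (s j) + r
  else Num.max (\big[Num.max/0]_(j < n | j != i) gam i j (s j)) r.

Lemma mixed_gainE s r i : mixed_gain s r i =
  if i \in ISig then Gamma ISig gam s i + r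
  else Num.max (Gamma ISig gam s i) r.
Proof. by rewrite /mixed_gain /Gamma; case: ifP. Qed.

Lemma le_mixed_gain s s' r r' i : (forall j, j != i -> 0 <= s j <= s' j) ->
  r <= r' -> mixed_gain s r i <= mixed_gain s' r' i.
Proof.
move=> ss' rr'; rewrite /mixed_gain; case: ifP => _.
  by rewrite lerD// ler_sum// => j /ss'/andP[s0 sj]; exact: (classK0_le (Hgam i j)).
rewrite ge_max !le_max rr' orbT andbT; apply/orP; left; apply/bigmax_leP.
split; first exact: bigmax_ge_id.
move=> j ji; have /andP[s0 sj] := ss' _ ji.
apply: le_trans (classK0_le (Hgam i j) s0 sj) _.
exact: (@le_bigmax_cond _ _ _ 0 j (fun j => j != i) (fun j => gam i j (s' j))).
Qed.

(** Finitely many continuous gains admit a common [d]. The error [e / (n + 1)] per gain keeps a sum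
    of at most [n] errors below [e], also for [n = 0]. *)
Lemma mixed_gain_right_continuous s r i e : (forall j, 0 <= s j) -> 0 < e ->
  exists2 d, 0 < d & mixed_gain (fun j => s j + d) r i <= mixed_gain s r i + e.
Proof.
move=> s0 e0; set e' := e / (n%:R + 1).
have n1 : (0 : R) < n%:R + 1 by rewrite ltr_wpDl.
have e'0 : 0 < e' by rewrite divr_gt0.
have nearj j : \forall d \near 0^'+, gam i j (s j + d) <= gam i j (s j) + e'.
  have [dj dj0 hj] := (within_Rplus_continuousP _).1
    (classK0_continuous (Hgam i j)) _ (s0 j) _ e'0.
  near=> d.
  have d0 : 0 < d by near: d; exact: nbhs_right_gt.
  have ddj : d < dj by near: d; exact: nbhs_right_lt.
  have := hj (s j + d); rewrite addr_ge0 ?(ltW d0)// => /(_ isT).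
  rewrite opprD addrA subrr add0r normrN gtr0_norm// => /(_ ddj).
  by rewrite ltr_distlC => /andP[_ /ltW].
have near_gam : \forall d \near 0^'+, forall j, gam i j (s j + d) <= gam i j (s j) + e'.
  exact: filter_forall.
near (0 : R)^'+ => d.
have gamle : forall j, gam i j (s j + d) <= gam i j (s j) + e' by near: d.
exists d; first by near: d; exact: nbhs_right_gt.
rewrite /mixed_gain; case: ifP => _.
  rewrite addrAC lerD2r; apply: (@le_trans _ _
    (\sum_(j < n | j != i) (gam i j (s j) + e'))); first exact: ler_sum.
  rewrite big_split/= lerD2l; apply: (@le_trans _ _ (\sum_(j < n) e')).
    by rewrite [leRHS](bigD1 i)//= lerDr ltW.
  rewrite sumr_const card_ord -mulr_natl /e' mulrCA ler_piMr ?ltW//.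
  by rewrite ltr_pdivrMr//; lra.
have e'e : e' <= e by rewrite ler_pdivrMr// mulrDr mulr1 lerDr mulr_ge0// ltW.
rewrite ge_max; apply/andP; split; last first.
  by apply: (@le_trans _ _ r); [lra|rewrite ler_wpDr ?(ltW e0)// le_max lexx orbT].
apply/bigmax_leP; split.
  by rewrite addr_ge0 ?(ltW e0)// le_max bigmax_ge_id.
move=> j ji; rewrite (le_trans (gamle j))// lerD// le_max; apply/orP; left.
exact: (@le_bigmax_cond _ _ _ 0 j (fun j => j != i) (fun j => gam i j (s j))).
Unshelve. all: by end_near. Qed.

End mixed_gain.

(** * Asymptotic gain of the whole system *)

Unset Implicit Arguments. Set Strict Implicit.

Theorem theorem2 (R : realType) (n : nat)
  (N m : 'I_n -> nat)
  (* the vector fields f_i(x_1, ..., x_n, u_i) *)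
  (f : forall i : 'I_n, bvec R N -> vec R (m i) -> vec R (N i))
  (* norms |.| on R^{N_i}, on R^{m_i}, on x = (x_1,..,x_n), on u = (u_1,..,u_n) *)
  (nrmS : forall i : 'I_n, vec R (N i) -> R)
  (nrmUi : forall i : 'I_n, vec R (m i) -> R)
  (nrmX : bvec R N -> R) (nrmU : bvec R m -> R)
  (HnS : forall i, is_vnorm (nrmS i)) (HnUi : forall i, is_vnorm (nrmUi i))
  (HnX : is_bnorm nrmX) (HnU : is_bnorm nrmU)
  (* standing assumptions: f_i continuous, locally Lipschitz in x
     uniformly in u_i with |u_i| <= r *)
  (Hcont : forall i (x : bvec R N) (v : vec R (m i)) (eps : R), 0 < eps ->
     exists2 del : R, 0 < del & forall x' v', nrmX (bsub x' x) < del ->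
       nrmUi i (vsub v' v) < del -> nrmS i (vsub (f i x' v') (f i x v)) < eps)
  (Hlip : forall i (r : R) (x0 : bvec R N), exists del L : R, 0 < del /\
     forall x y (v : vec R (m i)), nrmX (bsub x x0) < del -> nrmX (bsub y x0) < del ->
       nrmUi i v <= r -> nrmS i (vsub (f i x v) (f i y v)) <= L * nrmX (bsub x y))
  (* partition {1..n} = I_Sigma U I_max *)
  (ISig : {set 'I_n})
  (* gains *)
  (gam : 'I_n -> 'I_n -> R -> R) (gamu : 'I_n -> R -> R)
  (Hgam : forall i j, classK0 (gam i j)) (Hgamu : forall i, classK0 (gamu i))
  (* AG property of each subsystem, in the mixed sense *)
  (HAG : forall (i : 'I_n) (xi0 : vec R (N i)) (w : R -> bvec R N) (u : R -> bvec R m),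
     (forall j, j != i -> in_Linf (nrmS j) (fun t => w t j)) ->
     in_Linf_b nrmU u ->
     let Fi := fun t (z : vec R (N i)) => f i (bupd (w t) z) (u t i) in
     exists xi : R -> vec R (N i),
       [/\ is_solution Fi xi0 xi,
           (forall xi' : R -> vec R (N i), is_solution Fi xi0 xi' ->
              forall t, 0 <= t -> xi' t = xi t) &
           (limsup_oo (fun t => nrmS i (xi t)) <=
            (if i \in ISig then
               \sum_(j < n | j != i) gam i j (fine (Linf_norm (nrmS j) (fun t => w t j)))
               + gamu i (fine (Linf_norm nrmU u))
             else
               Num.max (\big[Num.max/0]_(j < n | j != i)
                          gam i j (fine (Linf_norm (nrmS j) (fun t => w t j))))
                       (gamu i (fine (Linf_norm nrmU u))))%:E)%E])
  (* solutions of the whole system exist for all positive times ... *)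
  (Hex : forall (x0 : bvec R N) (u : R -> bvec R m), in_Linf_b nrmU u ->
     exists x : R -> bvec R N, is_bsolution (fun t z => fun i => f i z (u t i)) x0 x)
  (* ... and are uniformly bounded *)
  (Hbnd : forall r : R, exists C : R,
     forall (x0 : bvec R N) (u : R -> bvec R m) (x : R -> bvec R N),
       nrmX x0 <= r -> in_Linf_b nrmU u -> (Linf_norm nrmU u <= r%:E)%E ->
       is_bsolution (fun t z => fun i => f i z (u t i)) x0 x ->
       forall t, 0 <= t -> nrmX (x t) <= C)
  (* small gain condition *)
  (Hsg : exists alpha : R -> R, classKinf alpha /\
     forall s : 'I_n -> R, (forall i, 0 <= s i) -> (exists i, s i != 0) ->
       exists i, Gamma ISig gam (Dalpha ISig alpha s) i < s i) :
  (* AG property of the whole system *)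
  exists g : R -> R, classK g /\
    forall (x0 : bvec R N) (u : R -> bvec R m) (x : R -> bvec R N),
      in_Linf_b nrmU u ->
      is_bsolution (fun t z => fun i => f i z (u t i)) x0 x ->
      (limsup_oo (fun t => nrmX (x t)) <= (g (fine (Linf_norm nrmU u)))%:E)%E.
Proof.
have [alpha [Kalpha sg]] := Hsg.
have [phi Kphi phiP] := small_gain_bound Hgam Kalpha sg.
have [CX CX0 CXP] := bnorm_le_sum_block HnX HnS.
have [CS CS0 CSP] := block_le_bnorm HnX HnS.
have nS0 i v : 0 <= nrmS i v by exact: (vnorm_ge0 HnS).
have nU0 v : 0 <= nrmU v by exact: (bnorm_ge0 HnU).
(* [rho U] bounds all input terms at once; the summand [U] puts it in class K. *)
pose rho U : R := U + \sum_(i < n) gamu i U.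
have Krho : classK rho by apply: classK_sum => //; exact: classK_id.
exists (fun U => CX * (n%:R + 1) * phi (rho U)); split.
  apply: classKZ; first by rewrite mulr_gt0// ltr_wpDl.
  exact: (classK_comp Kphi Krho).
move=> x0 u x uL solx; set U := fine (Linf_norm nrmU u).
have Ufin : Linf_norm nrmU u \is a fin_num.
  by rewrite ge0_fin_numE ?Linf_norm_ge0//; case: uL.
have U0 : 0 <= U by rewrite fine_ge0// Linf_norm_ge0.
(* Bounds [a] on the blocks after [tau] bound the input norms of the subsystem restarted at [tau];
   its solution [xi] is the shifted block by uniqueness. *)
have gain_asymp (a : 'I_n -> R) (tau : R) i e : 0 <= tau -> 0 < e ->
    (forall j t, tau <= t -> nrmS j (x t j) <= a j) ->
    exists T, forall t, T <= t ->
      nrmS i (x t i) <= mixed_gain ISig gam a (gamu i U) i + e.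
  move=> tau0 e0 xa.
  have xaL j : (Linf_norm (nrmS j) (fun t => x (t + tau)%R j) <= (a j)%:E)%E.
    by apply: Linf_norm_le => t t0; apply: xa; rewrite lerDr.
  have [|xi [_ xiuniq xilim]] := HAG i (x tau i) (fun t => x (t + tau))
      (fun t => u (t + tau)) _ (in_Linf_b_shift tau0 uL).
    move=> j _; split; first by move=> k; exact: measurable_shift_bsolution solx _ tau0 _ _.
    exact: le_lt_trans (xaL j) (ltry _).
  have {}xiuniq := xiuniq _ (shift_bsolution solx tau0 i).
  have {}xilim : (limsup_oo (fun t => nrmS i (xi t)) <
      (mixed_gain ISig gam a (gamu i U) i + e)%:E)%E.
    apply: le_lt_trans xilim _; rewrite lte_fin.
    apply: le_lt_trans (_ : _ <= mixed_gain ISig gam a (gamu i U) i) _; last lra.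
    apply: (@le_mixed_gain _ _ ISig gam Hgam (fun j =>
        fine (Linf_norm (nrmS j) (fun t => x (t + tau) j))) a) => [j _|].
      have L0 := @Linf_norm_ge0 _ _ (nrmS j) (fun t => x (t + tau) j) (nS0 j).
      rewrite fine_ge0//= -lee_fin fineK//.
      by rewrite ge0_fin_numE// (le_lt_trans (xaL j)) ?ltry.
    apply: (classK0_le (Hgamu i)); first by rewrite fine_ge0// Linf_norm_ge0.
    rewrite fine_le// ?Linf_norm_shift//.
    rewrite ge0_fin_numE ?Linf_norm_ge0// (le_lt_trans (Linf_norm_shift _ _ tau0))//.
    by case: uL.
  have [T T0 xiT] := limsup_oo_lt xilim.
  exists (T + tau) => t Tt; have := xiT (t - tau).
  by rewrite -xiuniq ?subrK//; [apply; lra|lra].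
pose s i := fine (limsup_oo (fun t => nrmS i (x t i))).
have lim0 i : (0 <= limsup_oo (fun t => nrmS i (x t i)))%E by exact: limsup_oo_ge0.
have sE i : (s i)%:E = limsup_oo (fun t => nrmS i (x t i)).
  rewrite fineK// ge0_fin_numE//.
  (* Uniform boundedness makes the limsups finite, so that they may be treated as reals. *)
  have [C Cbnd] := Hbnd (Num.max (nrmX x0) U).
  apply: le_lt_trans (ltry (CS * C)); apply: (@limsup_oo_le _ _ _ 0) => t t0.
  rewrite (le_trans (CSP _ _))// ler_pM2l// (Cbnd x0 u)// ?le_max ?lexx//.
  by rewrite -(fineK Ufin) lee_fin le_max lexx orbT.
have s0 i : 0 <= s i by rewrite -lee_fin sE.
have s_asymp d : 0 < d -> exists2 tau, 0 <= tau &
    forall j t, tau <= t -> nrmS j (x t j) <= s j + d.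
  move=> d0.
  have : forall j, exists T, 0 <= T /\ forall t, T <= t -> nrmS j (x t j) <= s j + d.
    move=> j; have : (limsup_oo (fun t => nrmS j (x t j)) < (s j + d)%:E)%E.
      by rewrite -sE lte_fin ltrDl.
    by move=> /limsup_oo_lt[T T0 hT]; exists T.
  (* The sum of the nonnegative thresholds serves as a common one. *)
  move=> /choice[T /all_and2[T0 hT]]; exists (\sum_j T j); first exact: sumr_ge0.
  move=> j t Tt; apply: hT; apply: le_trans Tt.
  by rewrite (bigD1 j)//= lerDl sumr_ge0.
have s_gain i : s i <= mixed_gain ISig gam s (gamu i U) i.
  (* One half of [e] pays for replacing [s] by [s + d], the other for the asymptotic estimate. *)
  apply/ler_addgt0Pr => e e0; have e20 : 0 < e / 2 by lra.
  have [d d0 hd] := mixed_gain_right_continuous ISig Hgam (gamu i U) i s0 e20.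
  have [tau tau0 htau] := s_asymp d d0.
  have [T hT] := gain_asymp _ tau i _ tau0 e20 htau.
  by have := limsup_oo_le hT; rewrite -sE lee_fin; lra.
have s_phi i : s i <= phi (rho U).
  apply: phiP => // [|j]; first exact: classK_ge0.
  rewrite -mixed_gainE; apply: le_trans (s_gain j) _.
  apply: le_mixed_gain => // [k _|]; first by rewrite s0 lexx.
  rewrite /rho (bigD1 j)//= addrCA lerDl addr_ge0// sumr_ge0// => k _.
  exact: (classK0_ge0 (Hgamu k)).
have phi0 : 0 <= phi (rho U) by do 2 apply: classK_ge0 => //.
apply/lee_addgt0Pr => e e0.
have n1 : (0 : R) < n%:R + 1 by rewrite ltr_wpDl.
have K0 : 0 < CX * (n%:R + 1) by rewrite mulr_gt0.
(* This excess per block adds up to at most [e] after summing [n] blocks and multiplying by [CX]. *)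
have [tau tau0 htau] := s_asymp (e / (CX * (n%:R + 1))) (divr_gt0 e0 K0).
rewrite -EFinD; apply: (limsup_oo_le (T := tau)) => t taut.
apply: le_trans (CXP _) _.
apply: (@le_trans _ _ (CX * \sum_(i < n) (phi (rho U) + e / (CX * (n%:R + 1))))).
  by rewrite ler_pM2l// ler_sum// => i _; rewrite (le_trans (htau i t taut))// lerD2r.
set p := phi (rho U) + _.
have -> : CX * (n%:R + 1) * phi (rho U) + e = CX * (n%:R + 1) * p.
  by rewrite /p [RHS]mulrDr [X in _ = _ + X]mulrC divfK ?gt_eqF.
rewrite sumr_const card_ord -[p *+ n]mulr_natl mulrA ler_wpM2r//.
  by rewrite addr_ge0// divr_ge0// ltW.
by rewrite ler_pM2l// lerDl.
Qed.
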